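(* Let $G$ be an Abelian group and $M$ a nonempty set, and let an affine structure on $M$ be given, i.e. a covariant single transitive right-side representation of $G$ in $M$; write $A+a$ for the image of the point $A\in M$ under the transformation generated by $a\in G$. Then, with set of points $M$, set of vectors $G$, and $\overline{AB}$ denoting the element $a\in G$ such that $B=A+a$, the following hold: (1) there exists at least one point; (2) to every pair of points $(A,B)$ there corresponds one and only one vector $\overline{AB}$; (3) for any point $A$ and any vector $a$ there exists one and only one point $B$ such that $\overline{AB}=a$; (4) if $\overline{AB}=\overline{CD}$, then $\overline{AC}=\overline{BD}$.
   Context: A covariant right-side representation of the (additively written) Abelian group $G$ in $M$ is a right action: $A+0=A$ and $(A+a)+b=A+(a+b)$ for $A\in M$, $a,b\in G$. It is effective if distinct elements of $G$ induce distinct transformations of $M$; transitive if for any $A,B\in M$ there is $a\in G$ with $B=A+a$; single transitive if it is both transitive and effective. *)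

(* Defs.v *)
From mathcomp Require Import all_boot all_algebra.
From mathcomp Require Import boolp classical_sets.

Set Implicit Arguments.
Unset Strict Implicit.
Unset Printing Implicit Defensive.

Import GRing.Theory.
Local Open Scope ring_scope.
Local Open Scope classical_set_scope.

Section RightRepresentation.
Variables (G : zmodType) (M : Type) (act : M -> G -> M).

Definition covariant_right_rep : Prop :=
  (forall A : M, act A 0 = A) /\
  (forall (A : M) (a b : G), act (act A a) b = act A (a + b)).

(* Transformations of M are compared extensionally. *)
Definition effective_rep : Prop :=
  forall a b : G, a <> b -> ~ (act^~ a =1 act^~ b).

Definition transitive_rep : Prop :=
  forall A B : M, exists a : G, B = act A a.

Definition single_transitive_rep : Prop :=
  transitive_rep /\ effective_rep.

Definition affine_structure : Prop :=
  covariant_right_rep /\ single_transitive_rep.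

(* "The" a with B = A + a; the value is the junk default 0 if there is no
   such a, and a chosen one if there are several. *)
Definition affine_vector (A B : M) : G := xget 0 [set a | B = act A a].

End RightRepresentation.

(* Main.v *)
Require Import Defs.
From mathcomp Require Import all_boot all_algebra.
From mathcomp Require Import boolp classical_sets.

(** The point is that a transitive effective action of an Abelian group is
    free.  If [a] and [b] agree at one point [A], they agree at every point
    [A + c], because translation by [c] commutes with both; by transitivity
    these are all the points, so effectiveness gives [a = b]
    ([act_inj_affine]).  Hence the vector from [A] to [B] is well defined, and
    it is characterized by [B = A + a] ([affine_vectorE]), which settles the
    existence and uniqueness claims.  The parallelogram law is commutativity
    again: if [B = A + v], [D = C + v] and [C = A + w], then
    [D = A + w + v] = [A + v + w] = [B + w]. *)

(** Commutativity is essential here: the natural action of a noncommutative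
    transitive permutation group is effective, but its nontrivial elements may
    have fixed points. *)
Lemma act_inj_affine (G : zmodType) (M : Type) (act : M -> G -> M) (A : M) :
  affine_structure act -> injective (act A).
Proof.
move=> [[_ actD] [act_trans act_eff]] a b eqAab.
have [//|/eqP neq_ab] := eqVneq a b; case: (act_eff _ _ neq_ab) => B.
have [c ->] := act_trans A B.
by rewrite !actD ![(c + _)%R]GRing.addrC -!actD eqAab.
Qed.

Lemma act_affine_vector (G : zmodType) (M : Type) (act : M -> G -> M)
    (A B : M) :
  affine_structure act -> B = act A (affine_vector act A B).
Proof.
move=> [_ [act_trans _]]; have [a Ba] := act_trans A B.
exact: (@xgetPex _ 0%R [set a | B = act A a]%classic (ex_intro _ a Ba)).
Qed.

Lemma affine_vectorE (G : zmodType) (M : Type) (act : M -> G -> M)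
    (A B : M) (a : G) :
  affine_structure act -> affine_vector act A B = a <-> B = act A a.
Proof.
move=> aff; split=> [<-|Ba]; first exact: act_affine_vector.
by apply: (act_inj_affine _ _ _ A aff); rewrite -act_affine_vector.
Qed.

Theorem theorem6p2p2 (G : zmodType) (M : Type) (act : M -> G -> M)
    (M_nonempty : inhabited M) (act_affine : affine_structure act) :
  (exists A : M, True) /\
  (forall A B : M, unique (fun a : G => B = act A a) (affine_vector act A B)) /\
  (forall (A : M) (a : G), exists! B : M, affine_vector act A B = a) /\
  (forall A B C D : M,
     affine_vector act A B = affine_vector act C D ->
     affine_vector act A C = affine_vector act B D).
Proof.
split; first by case: M_nonempty => A; exists A.
split.
  move=> A B; split; first exact: act_affine_vector.
  by move=> a /affine_vectorE; apply.
split.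
  move=> A a; exists (act A a); split; first exact/affine_vectorE.
  by move=> B /affine_vectorE ->.
move=> A B C D eqABCD; symmetry; apply/affine_vectorE => //.
have [[_ actD] _] := act_affine.
rewrite {1}(act_affine_vector _ _ _ C D act_affine) -eqABCD.
rewrite {1}(act_affine_vector _ _ _ A C act_affine).
rewrite {2}(act_affine_vector _ _ _ A B act_affine).
by rewrite !actD GRing.addrC.
Qed.
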